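(* Let $(Q,\&,k)$ be a commutative unital quantale with at least two elements. Then the powerset monad $(\mathscr{U},\mathsf{m},\mathsf{e})$ in $\mathsf{Set}(Q)$ is a submonad of the double contravariant powerset monad $(\mathfrak{P},\mu,\eta)$ in $\mathsf{Set}(Q)$; that is, there is a monad map $\kappa$ from $(\mathscr{U},\mathsf{m},\mathsf{e})$ to $(\mathfrak{P},\mu,\eta)$ which, as a morphism between functors, is a monomorphism.
   Context: A unital quantale $(Q,\&,k)$ is a monoid with unit $k$ whose underlying set $Q$ is a complete lattice (top $1$, bottom $0$) such that $\&$ distributes over arbitrary suprema in each variable; it is commutative if $p\,\&\,q=q\,\&\,p$ for all $p,q\in Q$. For $p,q,r\in Q$ put $r/q=\bigvee\{p\in Q\mid p\,\&\,q\le r\}$ and $p\backslash r=\bigvee\{q\in Q\mid p\,\&\,q\le r\}$ (these satisfy $q\backslash p=p/q$ when $Q$ is commutative). For a set $X$ and $\lambda,\gamma\in Q^X$ put $\lambda\swarrow\gamma=\bigwedge_{x\in X}\lambda(x)/\gamma(x)$ and $\gamma\searrow\lambda=\bigwedge_{x\in X}\gamma(x)\backslash\lambda(x)$. For $x\in X$ and $r\in Q$, $r_x\in Q^X$ is the map with $r_x(x)=r$ and $r_x(y)=0$ for $y\ne x$. For a map $f\colon X\to Y$ and $\gamma\in Q^X$, $f(\gamma)\in Q^Y$ is given by $f(\gamma)(y)=\bigvee\{\gamma(x)\mid f(x)=y\}$. The Goguen category $\mathsf{Set}(Q)$ has as objects the pairs $(X,\alpha)$ with $X$ a set and $\alpha\colon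 X\to Q$ a map; a morphism (Goguen map) $f\colon(X,\alpha)\to(Y,\beta)$ is a map $f\colon X\to Y$ with $\alpha(x)\le\beta(f(x))$ for all $x\in X$; composition is that of maps. The powerset monad $(\mathscr{U},\mathsf{m},\mathsf{e})$ in $\mathsf{Set}(Q)$: $\mathscr{U}(X,\alpha)=(Q^X,\alpha^\downarrow)$ with $\alpha^\downarrow(\gamma)=\alpha\swarrow\gamma$; $\mathscr{U}f(\gamma)=f(\gamma)$; the unit is $\mathsf{e}_{(X,\alpha)}(x)=k_x$; the multiplication is $\mathsf{m}_{(X,\alpha)}(\Lambda)(x)=\bigvee_{\gamma\in Q^X}\Lambda(\gamma)\,\&\,\gamma(x)$ for $\Lambda\in Q^{Q^X}$, $x\in X$. The double contravariant powerset monad $(\mathfrak{P},\mu,\eta)$ in $\mathsf{Set}(Q)$: $\mathfrak{P}(X,\alpha)=(Q^{Q^X},(\alpha_\dag^\uparrow)^\uparrow)$ with $(\alpha_\dag^\uparrow)^\uparrow(\Lambda)=\bigwedge_{\gamma\in Q^X}\big(\Lambda(\gamma)/(\alpha\searrow\gamma)\big)$ for $\Lambda\in Q^{Q^X}$; for a Goguen map $f\colon(X,\alpha)\to(Y,\beta)$, $\mathfrak{P}f(\Lambda)(\gamma)=\Lambda(\gamma\circ f)$ for $\Lambda\in Q^{Q^X}$, $\gamma\in Q^Y$; the unit is $\eta_{(X,\alpha)}(x)(\gamma)=\gamma(x)$; the multiplication is $\mu_{(X,\alpha)}(\mathbb{H})(\gamma)=\mathbb{H}(\widehat{\gamma})$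 for $\mathbb{H}\colon Q^{Q^{Q^X}}\to Q$ and $\gamma\in Q^X$, where $\widehat{\gamma}(\Lambda)=\Lambda(\gamma)$ for $\Lambda\in Q^{Q^X}$. A monad map from a monad $(S,\mathsf{m},\mathsf{e})$ to a monad $(T,\mu,\eta)$ in the same category is a natural transformation $\kappa\colon S\to T$ with $\kappa\circ\mathsf{e}=\eta$ and $\mu\circ(\kappa*\kappa)=\kappa\circ\mathsf{m}$, where $\kappa*\kappa\colon S^2\to T^2$ is the horizontal composite. *)

(* Defs.v *)
From HB Require Import structures.
From mathcomp Require Import all_boot all_order.
From mathcomp Require Import boolp classical_sets.
Set Implicit Arguments.
Unset Strict Implicit.
Unset Printing Implicit Defensive.
Import Order.TTheory.
Local Open Scope classical_set_scope.
Local Open Scope order_scope.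

#[local] Obligation Tactic := idtac.

Record category := Category {
  obj :> Type;
  hom : obj -> obj -> Type;
  idm : forall a, hom a a;
  comp : forall a b c, hom b c -> hom a b -> hom a c;
  compA : forall a b c d (h : hom c d) (g : hom b c) (f : hom a b),
    comp h (comp g f) = comp (comp h g) f;
  comp1m : forall a b (f : hom a b), comp (idm b) f = f;
  compm1 : forall a b (f : hom a b), comp f (idm a) = f }.
Arguments idm {_} _.
Arguments comp {_ _ _ _} _ _.

Definition monomorphism (C : category) (a b : C) (f : hom a b) : Prop :=
  forall (c : C) (g h : hom c a), comp f g = comp f h -> g = h.

Record functor (C D : category) := Functor {
  fobj :> C -> D;
  fmap : forall a b, hom a b -> hom (fobj a) (fobj b);
  fmap1 : forall a, fmap (idm a) = idm (fobj a);
  fmapM : forall a b c (g : hom b c) (f : hom a b),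
    fmap (comp g f) = comp (fmap g) (fmap f) }.

Definition functor_id (C : category) : functor C C :=
  @Functor C C id (fun _ _ => id) (fun _ => erefl) (fun _ _ _ _ _ => erefl).

Program Definition functor_comp (C D E : category)
    (G : functor D E) (F : functor C D) : functor C E :=
  @Functor C E (fun a => G (F a)) (fun a b f => fmap G (fmap F f)) _ _.
Next Obligation. by move=> C D E G F a /=; rewrite !fmap1. Qed.
Next Obligation. by move=> C D E G F a b c g f /=; rewrite !fmapM. Qed.

Record nattrans (C D : category) (F G : functor C D) := Nattrans {
  ntapp :> forall a : C, hom (F a) (G a);
  natural : forall (a b : C) (f : hom a b),
    comp (fmap G f) (ntapp a) = comp (ntapp b) (fmap F f) }.

Lemma nattrans_eq (C D : category) (F G : functor C D) (s t : nattrans F G) :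
  (forall a, s a = t a) -> s = t.
Proof.
case: s t => [s ns] [t nt] /= st.
have e : s = t by apply: functional_extensionality_dep.
by rewrite -e in nt *; congr Nattrans; exact: Prop_irrelevance.
Qed.

Program Definition nattrans_id (C D : category) (F : functor C D) :
  nattrans F F := @Nattrans _ _ _ _ (fun a => idm (F a)) _.
Next Obligation. by move=> C D F a b f /=; rewrite comp1m compm1. Qed.

Program Definition nattrans_comp (C D : category) (F G H : functor C D)
    (t : nattrans G H) (s : nattrans F G) : nattrans F H :=
  @Nattrans _ _ _ _ (fun a => comp (t a) (s a)) _.
Next Obligation.
move=> C D F G H t s a b f /=.
by rewrite compA natural -compA natural compA.
Qed.

Program Definition nattrans_hcomp (C D E : category) (F F' : functor C D)
    (G G' : functor D E) (t : nattrans G G') (s : nattrans F F') :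
    nattrans (functor_comp G F) (functor_comp G' F') :=
  @Nattrans _ _ _ _ (fun a => comp (fmap G' (s a)) (t (F a))) _.
Next Obligation.
move=> C D E F F' G G' t s a b f /=.
by rewrite compA -fmapM (natural s) fmapM -compA (natural t) compA.
Qed.

Program Definition functor_category (C D : category) : category :=
  @Category (functor C D) (@nattrans C D) (@nattrans_id C D)
    (@nattrans_comp C D) _ _ _.
Next Obligation.
by move=> C D F G H K h g f; apply: nattrans_eq => a /=; rewrite compA.
Qed.
Next Obligation.
by move=> C D F G f; apply: nattrans_eq => a /=; rewrite comp1m.
Qed.
Next Obligation.
by move=> C D F G f; apply: nattrans_eq => a /=; rewrite compm1.
Qed.

Record monad (C : category) := Monad {
  mfun :> functor C C;
  munit : nattrans (functor_id C) mfun;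
  mmult : nattrans (functor_comp mfun mfun) mfun;
  mmultA : forall a,
    comp (mmult a) (fmap mfun (mmult a)) = comp (mmult a) (mmult (mfun a));
  mmult_unitl : forall a, comp (mmult a) (munit (mfun a)) = idm (mfun a);
  mmult_unitr : forall a, comp (mmult a) (fmap mfun (munit a)) = idm (mfun a) }.

Definition monad_map (C : category) (S T : monad C) (kappa : nattrans S T) :
    Prop :=
  nattrans_comp kappa (munit S) = munit T /\
  nattrans_comp (mmult T) (nattrans_hcomp kappa kappa) =
    nattrans_comp kappa (mmult S).

HB.mixin Record isCompleteLattice (d : Order.disp_t) T of Order.TBLattice d T := {
  bigsup : set T -> T;
  bigsupP : forall A, supremums A (bigsup A)
}.

#[short(type="completeLatticeType")]
HB.structure Definition CompleteLattice (d : Order.disp_t) :=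
  { T of Order.TBLattice d T & isCompleteLattice d T }.

(* The product & is mulg, its unit k is 1%g; the least and greatest elements, *)
(* 0 and 1 in the usual notation of quantales, are \bot and \top.            *)
HB.mixin Record isQuantale (d : Order.disp_t) T
    of CompleteLattice d T & Monoid T := {
  mul_bigsupr : forall (p : T) (A : set T),
    (p * bigsup A)%g = bigsup [set (p * q)%g | q in A];
  mul_bigsupl : forall (A : set T) (q : T),
    (bigsup A * q)%g = bigsup [set (p * q)%g | p in A]
}.

#[short(type="quantaleType")]
HB.structure Definition Quantale (d : Order.disp_t) :=
  { T of CompleteLattice d T & Monoid T & isQuantale d T }.

Section CompleteLatticeTheory.
Context (d : Order.disp_t) (L : completeLatticeType d).
Implicit Types (A : set L) (x y z : L).

Definition biginf A : L := bigsup (lbound A).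

Lemma bigsup_leP A z : bigsup A <= z <-> (forall x, A x -> x <= z).
Proof.
have [ubA lubA] := bigsupP A.
split=> [Az x Ax|Az]; first exact: le_trans (ubA x Ax) Az.
exact: lubA.
Qed.

Lemma le_biginfP A z : z <= biginf A <-> (forall x, A x -> z <= x).
Proof.
have [ubA lubA] := bigsupP (lbound A).
split=> [zA x Ax|zA]; last by apply: ubA => x; exact: zA.
by apply: le_trans zA _; apply: lubA => y; apply.
Qed.

Lemma eq_le_r x y : (forall z, x <= z <-> y <= z) -> x = y.
Proof.
by move=> xy; apply/eqP; rewrite eq_le; apply/andP; split; apply/xy.
Qed.

End CompleteLatticeTheory.

Section Residuals.
Context (d : Order.disp_t) (Q : quantaleType d).
Implicit Types p q r : Q.

(* over r q is the residual r / q, and under p r is p \ r. *)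
Definition over r q : Q := bigsup [set p | (p * q)%g <= r].
Definition under p r : Q := bigsup [set q | (p * q)%g <= r].

Lemma mul_lel p q r : p <= q -> (p * r)%g <= (q * r)%g.
Proof.
move=> pq; have -> : q = bigsup [set p; q].
  apply: eq_le_r => z; rewrite bigsup_leP; split=> [qz x [->|->] //|]; last first.
    by apply; right.
  exact: le_trans pq qz.
rewrite mul_bigsupl.
by have /bigsup_leP := lexx (bigsup [set (p * r)%g | p in [set p; q]]); apply;
  exists p => //; left.
Qed.

Lemma mul_ler p q r : p <= q -> (r * p)%g <= (r * q)%g.
Proof.
move=> pq; have -> : q = bigsup [set p; q].
  apply: eq_le_r => z; rewrite bigsup_leP; split=> [qz x [->|->] //|]; last first.
    by apply; right.
  exact: le_trans pq qz.
rewrite mul_bigsupr.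
by have /bigsup_leP := lexx (bigsup [set (r * p)%g | p in [set p; q]]); apply;
  exists p => //; left.
Qed.

Lemma le_overP p q r : p <= over r q <-> (p * q)%g <= r.
Proof.
split=> [pr|pqr]; last by have [ub _] := bigsupP [set p | (p * q)%g <= r]; exact: ub.
apply: le_trans (mul_lel q pr) _; rewrite mul_bigsupl.
by apply/bigsup_leP => _ [p' ? <-].
Qed.

Lemma le_underP p q r : q <= under p r <-> (p * q)%g <= r.
Proof.
split=> [qr|pqr]; last by have [ub _] := bigsupP [set q | (p * q)%g <= r]; exact: ub.
apply: le_trans (mul_ler p qr) _; rewrite mul_bigsupr.
by apply/bigsup_leP => _ [p' ? <-].
Qed.

Lemma mul0q q r : (\bot * q)%g <= r.
Proof. by apply/le_overP; exact: le0x. Qed.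

Lemma mulq0 q r : (q * \bot)%g <= r.
Proof. by apply/le_underP; exact: le0x. Qed.

Context (X : Type).
Implicit Types l g : X -> Q.

Definition swarrow l g : Q := biginf (range (fun x => over (l x) (g x))).
Definition searrow g l : Q := biginf (range (fun x => under (g x) (l x))).

Lemma le_swarrowP z l g : z <= swarrow l g <-> forall x, (z * g x)%g <= l x.
Proof.
rewrite le_biginfP; split=> [H x|H _ [x _ <-]]; last exact/le_overP.
by apply/le_overP/H; exists x.
Qed.

Lemma le_searrowP z g l : z <= searrow g l <-> forall x, (g x * z)%g <= l x.
Proof.
rewrite le_biginfP; split=> [H x|H _ [x _ <-]]; last exact/le_underP.
by apply/le_underP/H; exists x.
Qed.

(* single r x is the map r_x. *)
Definition single r (x : X) : X -> Q := fun y => if `[< y = x >] then r else \bot.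

End Residuals.

Definition qimage (d : Order.disp_t) (Q : quantaleType d) (X Y : Type)
  (f : X -> Y) (g : X -> Q) : Y -> Q :=
  fun y => bigsup [set g x | x in [set x | f x = y]].

Lemma qimage_leP (d : Order.disp_t) (Q : quantaleType d) (X Y : Type)
    (f : X -> Y) (g : X -> Q) y z :
  qimage f g y <= z <-> forall x, f x = y -> g x <= z.
Proof.
rewrite bigsup_leP; split=> [H x fx|H _ [x fx <-]]; last exact: H.
by apply: H; exists x.
Qed.

Record goguen_obj (Q : Type) := GoguenObj {
  carrier :> Type;
  degree : carrier -> Q }.

Record goguen_map (d : Order.disp_t) (Q : quantaleType d)
    (X Y : goguen_obj Q) := GoguenMap {
  gmap :> X -> Y;
  gmap_le : forall x : X, degree x <= degree (gmap x) }.

Lemma goguen_map_eq (d : Order.disp_t) (Q : quantaleType d)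
    (X Y : goguen_obj Q) (f g : goguen_map X Y) : f =1 g -> f = g.
Proof.
case: f g => [f fle] [g gle] /= /funext fg.
by rewrite -fg in gle *; congr GoguenMap; exact: Prop_irrelevance.
Qed.

Definition goguen_id (d : Order.disp_t) (Q : quantaleType d)
  (X : goguen_obj Q) : goguen_map X X :=
  GoguenMap (gmap := id) (fun x => lexx _).

Definition goguen_comp (d : Order.disp_t) (Q : quantaleType d)
  (X Y Z : goguen_obj Q) (g : goguen_map Y Z) (f : goguen_map X Y) :
  goguen_map X Z :=
  GoguenMap (gmap := fun x => g (f x))
    (fun x => le_trans (gmap_le f x) (gmap_le g (f x))).

Program Definition goguen (d : Order.disp_t) (Q : quantaleType d) : category :=
  @Category (goguen_obj Q) (@goguen_map d Q) (@goguen_id d Q)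
    (@goguen_comp d Q) _ _ _.
Next Obligation. by move=> *; exact: goguen_map_eq. Qed.
Next Obligation. by move=> *; exact: goguen_map_eq. Qed.
Next Obligation. by move=> *; exact: goguen_map_eq. Qed.

Section PowersetMonad.
Context (d : Order.disp_t) (Q : quantaleType d).
Implicit Types X Y : goguen_obj Q.

Definition pow_obj X : goguen_obj Q :=
  GoguenObj (fun g : X -> Q => swarrow (@degree _ X) g).

Program Definition pow_map X Y (f : goguen_map X Y) :
    goguen_map (pow_obj X) (pow_obj Y) :=
  @GoguenMap d Q (pow_obj X) (pow_obj Y) (fun g => qimage f g) _.
Next Obligation.
move=> X Y f g /=.
apply/le_swarrowP => y; apply/le_underP/qimage_leP => x <-; apply/le_underP.
apply: le_trans (gmap_le f x); move: x.
exact/le_swarrowP.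
Qed.

Program Definition pow_functor : functor (goguen Q) (goguen Q) :=
  @Functor (goguen Q) (goguen Q) pow_obj pow_map _ _.
Next Obligation.
move=> X; apply: goguen_map_eq => g; apply: funext => y /=.
apply: eq_le_r => z; rewrite qimage_leP.
by split=> [H|H x -> //]; exact: H.
Qed.
Next Obligation.
move=> X Y Z g f; apply: goguen_map_eq => l; apply: funext => y /=.
apply: eq_le_r => z; rewrite !qimage_leP; split.
  by move=> H y' gy'; apply/qimage_leP => x fx; apply: H; rewrite /= fx.
by move=> H x fx; have /qimage_leP := H _ fx; exact.
Qed.

Program Definition pow_unit_map X : goguen_map X (pow_obj X) :=
  @GoguenMap d Q X (pow_obj X) (fun x => single 1%g x) _.
Next Obligation.
move=> X x /=.
apply/le_swarrowP => y; rewrite /single; case: asboolP => [->|_].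
  by rewrite mulg1.
exact: mulq0.
Qed.

Program Definition pow_unit : nattrans (functor_id (goguen Q)) pow_functor :=
  @Nattrans _ _ (functor_id (goguen Q)) pow_functor pow_unit_map _.
Next Obligation.
move=> X Y f; apply: goguen_map_eq => x; apply: funext => y /=.
apply: eq_le_r => z; rewrite qimage_leP /single; split=> [H|H x' fx'].
  by case: asboolP => [yx|_]; [have := H x (esym yx); rewrite asboolT|exact: le0x].
by case: asboolP => [xx'|_]; [rewrite -fx' xx' asboolT in H|exact: le0x].
Qed.

Definition qmult (X : Type) (L : (X -> Q) -> Q) : X -> Q :=
  fun x => bigsup (range (fun g => L g * g x)%g).

Lemma qmult_leP (X : Type) (L : (X -> Q) -> Q) x z :
  qmult L x <= z <-> forall g, (L g * g x)%g <= z.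
Proof.
rewrite bigsup_leP; split=> [H g|H _ [g _ <-]]; last exact: H.
by apply: H; exists g.
Qed.

Program Definition pow_mult_map X :
    goguen_map (pow_obj (pow_obj X)) (pow_obj X) :=
  @GoguenMap d Q (pow_obj (pow_obj X)) (pow_obj X) (fun L => qmult L) _.
Next Obligation.
move=> X L; apply/le_swarrowP => x; apply/le_underP/qmult_leP => g.
apply/le_underP; rewrite mulgA; move: x; apply/le_swarrowP.
by have /le_swarrowP := lexx (degree L); exact.
Qed.

Program Definition pow_mult :
    nattrans (functor_comp pow_functor pow_functor) pow_functor :=
  @Nattrans _ _ (functor_comp pow_functor pow_functor) pow_functor
    pow_mult_map _.
Next Obligation.
move=> X Y f; apply: goguen_map_eq => L; apply: funext => y /=.
apply: eq_le_r => z; rewrite qimage_leP qmult_leP; split=> H.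
  move=> l; apply/le_overP/qimage_leP => g <-; apply/le_overP/le_underP.
  apply/qimage_leP => x fx; apply/le_underP.
  by have /qmult_leP := H _ fx; exact.
move=> x fx; apply/qmult_leP => g.
have /le_overP/qimage_leP/(_ g erefl)/le_overP/le_underP := H (qimage f g).
by move=> /qimage_leP/(_ x fx)/le_underP.
Qed.

Program Definition powerset_monad : monad (goguen Q) :=
  @Monad _ pow_functor pow_unit pow_mult _ _ _.
Next Obligation.
move=> X; apply: goguen_map_eq => LL; apply: funext => x /=.
apply: eq_le_r => z; rewrite !qmult_leP; split=> H g.
  apply/le_overP/qmult_leP => L; apply/le_overP.
  have /le_overP/qimage_leP/(_ L erefl)/le_overP := H (qmult L).
  by move=> /le_underP/qmult_leP/(_ g)/le_underP; rewrite mulgA.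
apply/le_overP/qimage_leP => L <-; apply/le_overP/le_underP.
apply/qmult_leP => h; apply/le_underP; rewrite mulgA.
by have /le_overP/qmult_leP/(_ L)/le_overP := H h.
Qed.
Next Obligation.
move=> X; apply: goguen_map_eq => g; apply: funext => x /=.
apply: eq_le_r => z; rewrite qmult_leP; split=> [/(_ g)|H h].
  by rewrite /single asboolT // mul1g.
by rewrite /single; case: asboolP => [->|_]; [rewrite mul1g|exact: mul0q].
Qed.
Next Obligation.
move=> X; apply: goguen_map_eq => g; apply: funext => x /=.
apply: eq_le_r => z; rewrite qmult_leP; split=> [/(_ (single 1%g x))|H h].
  move=> /le_overP/qimage_leP/(_ x erefl)/le_overP.
  by rewrite /single asboolT // mulg1.
apply/le_overP/qimage_leP => y <-; apply/le_overP.
by rewrite /single; case: asboolP => [<-|_]; [rewrite mulg1|exact: mulq0].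
Qed.

End PowersetMonad.

Section DoublePowersetMonad.
Context (d : Order.disp_t) (Q : quantaleType d).
Implicit Types X Y : goguen_obj Q.

(* The degree of L is the meet of all L g / (alpha \searrow g). *)
Definition dpow_obj X : goguen_obj Q :=
  GoguenObj (fun L : (X -> Q) -> Q =>
    swarrow L (fun g => searrow (@degree _ X) g)).

Lemma le_dpow_degreeP X (L : dpow_obj X) z :
  z <= degree L <-> forall g, (z * searrow (@degree _ X) g)%g <= L g.
Proof. exact: le_swarrowP. Qed.

Program Definition dpow_map X Y (f : goguen_map X Y) :
    goguen_map (dpow_obj X) (dpow_obj Y) :=
  @GoguenMap d Q (dpow_obj X) (dpow_obj Y) (fun L g => L (g \o f)) _.
Next Obligation.
move=> X Y f L; apply/le_dpow_degreeP => g.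
have /le_dpow_degreeP/(_ (g \o f)) := lexx (degree L).
apply: le_trans; apply: mul_ler; apply/le_searrowP => x /=.
apply: le_trans (mul_lel _ (gmap_le f x)) _; move: (f x).
exact/le_searrowP.
Qed.

Program Definition dpow_functor : functor (goguen Q) (goguen Q) :=
  @Functor (goguen Q) (goguen Q) dpow_obj dpow_map _ _.
Next Obligation. by move=> X; exact: goguen_map_eq. Qed.
Next Obligation. by move=> X Y Z g f; exact: goguen_map_eq. Qed.

Program Definition dpow_unit_map X : goguen_map X (dpow_obj X) :=
  @GoguenMap d Q X (dpow_obj X) (fun x g => g x) _.
Next Obligation.
by move=> X x; apply/le_dpow_degreeP => g; move: x; apply/le_searrowP.
Qed.

Program Definition dpow_unit : nattrans (functor_id (goguen Q)) dpow_functor :=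
  @Nattrans _ _ (functor_id (goguen Q)) dpow_functor dpow_unit_map _.
Next Obligation. by move=> X Y f; exact: goguen_map_eq. Qed.

Definition qhat (X : Type) (g : X -> Q) : ((X -> Q) -> Q) -> Q :=
  fun L => L g.

Program Definition dpow_mult_map X :
    goguen_map (dpow_obj (dpow_obj X)) (dpow_obj X) :=
  @GoguenMap d Q (dpow_obj (dpow_obj X)) (dpow_obj X)
    (fun H g => H (qhat g)) _.
Next Obligation.
move=> X H; apply/le_dpow_degreeP => g.
have /le_dpow_degreeP/(_ (qhat g)) := lexx (degree H).
apply: le_trans; apply: mul_ler; apply/le_searrowP => L.
by move: g; apply/le_dpow_degreeP.
Qed.

Program Definition dpow_mult :
    nattrans (functor_comp dpow_functor dpow_functor) dpow_functor :=
  @Nattrans _ _ (functor_comp dpow_functor dpow_functor) dpow_functor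
    dpow_mult_map _.
Next Obligation. by move=> X Y f; exact: goguen_map_eq. Qed.

Program Definition double_powerset_monad : monad (goguen Q) :=
  @Monad _ dpow_functor dpow_unit dpow_mult _ _ _.
Next Obligation. by move=> X; exact: goguen_map_eq. Qed.
Next Obligation. by move=> X; exact: goguen_map_eq. Qed.
Next Obligation. by move=> X; exact: goguen_map_eq. Qed.

End DoublePowersetMonad.

(* Main.v *)
Require Import Defs.
From mathcomp Require Import all_boot all_order.
From mathcomp Require Import boolp classical_sets.

(** A fuzzy subset [g] of [X] acts on fuzzy subsets [l] of [X] by the degree
    [searrow g l] to which [g] is included in [l].  The monad map is this
    fuzzy inclusion, curried: it sends [g] to the functional [searrow g].

    Everything is read off the universal property of the residual,
    [z <= searrow g l] iff [g x * z <= l x] for all [x].  Since [*] preserves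
    suprema, it turns images along maps into precomposition (naturality) and
    the supremum defining the multiplication of the powerset monad into an
    iterated residual (compatibility with multiplications); inclusion of a
    singleton is evaluation (compatibility with units).  Commutativity serves
    twice: to swap the two factors in the iterated residual, and to get
    [z * searrow a l * g x <= (z * g x) * searrow a l <= l x] whenever
    [z * g x <= a x], so that the map respects degrees.

    The components are injective because fuzzy inclusion at the unit is the
    pointwise order: [searrow g] already determines the functions above [g].
    A natural transformation with injective components is a monomorphism. *)

Set Implicit Arguments.
Unset Strict Implicit.
Unset Printing Implicit Defensive.
Import Order.TTheory.
Local Open Scope order_scope.

Lemma eq_le_l (d : Order.disp_t) (L : porderType d) (x y : L) :
  (forall z, z <= x <-> z <= y) -> x = y.
Proof.
by move=> xy; apply/eqP; rewrite eq_le; apply/andP; split; apply/xy.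
Qed.

Section FuzzyInclusion.
Context (d : Order.disp_t) (Q : quantaleType d).

Lemma searrow_single (X : Type) (x : X) (l : X -> Q) :
  searrow (single 1%g x) l = l x.
Proof.
apply/eqP; rewrite eq_le; apply/andP; split.
  have /le_searrowP/(_ x) := lexx (searrow (single 1%g x) l).
  by rewrite /single asboolT // mul1g.
apply/le_searrowP => y; rewrite /single; case: asboolP => [->|_].
  by rewrite mul1g.
exact: mul0q.
Qed.

(** The image of [g] along [f] is left adjoint to precomposition with [f], in
    the enriched sense. *)
Lemma searrow_qimage (X Y : Type) (f : X -> Y) (g : X -> Q) (l : Y -> Q) :
  searrow (qimage f g) l = searrow g (l \o f).
Proof.
apply: eq_le_l => z; rewrite !le_searrowP; split=> [H x|H y].
  by have /le_overP/qimage_leP/(_ x erefl)/le_overP := H (f x).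
by apply/le_overP/qimage_leP => x <-; apply/le_overP/H.
Qed.

(** At the unit, fuzzy inclusion is the pointwise order, so [searrow g] knows
    which functions lie above [g]. *)
Lemma searrow_inj (X : Type) : injective (@searrow d Q X).
Proof.
have incl (g l : X -> Q) :
    (1%g : Q) <= searrow g l <-> forall x, g x <= l x.
  by rewrite le_searrowP; split=> H x; have := H x; rewrite mulg1.
move=> g l gl; apply: funext => x; apply/eqP; rewrite eq_le.
apply/andP; split; move: x; apply/incl.
  by rewrite gl; apply/incl.
by rewrite -gl; apply/incl.
Qed.

Hypothesis mulC : forall p q : Q, (p * q)%g = (q * p)%g.

(** Being included in [l] through the union [qmult L] means that [L] is
    included in the fuzzy set of all fuzzy subsets of [l]. *)
Lemma searrow_qmult (X : Type) (L : (X -> Q) -> Q) (l : X -> Q) :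
  searrow (qmult L) l = searrow L (fun g => searrow g l).
Proof.
apply: eq_le_l => z; rewrite !le_searrowP; split=> H.
  move=> g; apply/le_searrowP => x; rewrite mulgA (mulC (g x)).
  by have /le_overP/qmult_leP/(_ g)/le_overP := H x.
move=> x; apply/le_overP/qmult_leP => g; apply/le_overP.
by have /le_searrowP/(_ x) := H g; rewrite mulgA (mulC (g x)).
Qed.

(** [searrow] respects degrees: a scalar [z] pushing [g] below [a] turns
    inclusion of [a] in [l] into inclusion of [g] in [l]. *)
Lemma degree_searrow (X : goguen_obj Q) (g : X -> Q) :
  @degree _ (pow_obj X) g <= @degree _ (dpow_obj X) (searrow g).
Proof.
apply/le_dpow_degreeP => l; apply/le_searrowP => x.
rewrite mulgA (mulC (g x)).
have /le_swarrowP/(_ x) ga := lexx (@degree _ (pow_obj X) g).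
apply: le_trans (mul_lel _ ga) _.
by move: x {ga}; apply/le_searrowP.
Qed.

Definition inclusion_map (X : goguen_obj Q) :
    goguen_map (pow_obj X) (dpow_obj X) :=
  @GoguenMap d Q (pow_obj X) (dpow_obj X) (@searrow d Q X) (@degree_searrow X).

Lemma inclusion_natural (X Y : goguen_obj Q) (f : goguen_map X Y) :
  goguen_comp (dpow_map f) (inclusion_map X) =
    goguen_comp (inclusion_map Y) (pow_map f).
Proof.
apply: goguen_map_eq => g; apply: funext => l.
by rewrite /= searrow_qimage.
Qed.

Definition inclusion : nattrans (powerset_monad Q) (double_powerset_monad Q) :=
  @Nattrans _ _ (pow_functor Q) (dpow_functor Q) inclusion_map
    inclusion_natural.

Lemma inclusion_monad_map : monad_map inclusion.
Proof.
split; apply: nattrans_eq => X; apply: goguen_map_eq.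
  by move=> x; apply: funext => l; exact: searrow_single.
by move=> L; apply: funext => l; rewrite /= searrow_qmult.
Qed.

End FuzzyInclusion.

Lemma injective_monomorphism (d : Order.disp_t) (Q : quantaleType d)
    (C : category) (F G : functor C (goguen Q)) (t : nattrans F G) :
  (forall a, injective (gmap (t a))) ->
  @monomorphism (functor_category C (goguen Q)) F G t.
Proof.
move=> tinj E u v tuv; apply: nattrans_eq => a; apply: goguen_map_eq => x.
apply: (tinj a).
exact: (congr1 (fun s : nattrans E G => gmap (s a) x) tuv).
Qed.

Theorem theorem4p6 (d : Order.disp_t) (Q : quantaleType d)
    (Qcomm : forall p q : Q, (p * q)%g = (q * p)%g)
    (Q2 : exists p q : Q, p <> q) :
  exists kappa : nattrans (powerset_monad Q) (double_powerset_monad Q),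
    monad_map kappa /\
    @monomorphism (functor_category (goguen Q) (goguen Q))
      (powerset_monad Q) (double_powerset_monad Q) kappa.
Proof.
exists (inclusion Qcomm); split; first exact: inclusion_monad_map.
by apply: injective_monomorphism => X; exact: searrow_inj.
Qed.
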